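(* Let $m\geq 2$ be an integer, let $x$ be an indeterminate, and for integers $n\ge 0$ let $T_n=n(n+1)/2$. For each positive integer $M$ put $$L_{M,o}(x)=\sum_{j=1}^{M}(2j-1)^3+x^3+\sum_{j=2}^{M}\bigl((2j-2)+(j-1)x\bigr)^3,\qquad R_{M,o}(x)=\bigl(T_{2M-1}+(1+T_{M-1})x\bigr)^2,$$ $$L_{M,e}(x)=\sum_{j=1}^{M}(2j-1)^3+x^3+\sum_{j=1}^{M}(2j+jx)^3,\qquad R_{M,e}(x)=\bigl(T_{2M}+(1+T_{M})x\bigr)^2.$$ Let $$P_{m,o}(x)=\sum_{j=0}^{m}(4j+1+jx)\bigl((j+1)(j-2)+j^2x\bigr),$$ and let $P_{m,e}(x)$ be the polynomial obtained by substituting $-m-1$ for $m$ in the polynomial expansion of $P_{m,o}(x)$. Then $$L_{m+1,o}(x)-R_{m+1,o}(x)=xP_{m,o}(x)-x^2+x^3$$ and $$L_{m,e}(x)-R_{m,e}(x)=xP_{m,e}(x)-x^2+x^3.$$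
   Context: $T_n=\sum_{j=1}^n j=n(n+1)/2$ is the $n$th triangular number. The ''polynomial expansion of $P_{m,o}(x)$'' means the unique polynomial in the two variables $m$ and $x$ with rational coefficients that agrees with the sum $\sum_{j=0}^m (4j+1+jx)\bigl((j+1)(j-2)+j^2x\bigr)$ for all integers $m\ge 0$; $P_{m,e}(x)$ is obtained from this two-variable polynomial by replacing $m$ with $-m-1$. *)

(* Defs.v *)
From mathcomp Require Import all_boot all_order all_algebra.
From mathcomp Require Import ring.

Set Implicit Arguments.
Unset Strict Implicit.
Unset Printing Implicit Defensive.

Import Order.TTheory GRing.Theory Num.Theory.
Local Open Scope ring_scope.

Definition T (n : nat) : rat := n%:R * (n%:R + 1) / 2.

Definition L_o (M : nat) : {poly rat} :=
  \sum_(1 <= j < M.+1) (2 * j%:R - 1) ^+ 3 + 'X ^+ 3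
  + \sum_(2 <= j < M.+1) ((2 * j%:R - 2) + (j%:R - 1) * 'X) ^+ 3.

(* Only meaningful for M >= 1, where the nat predecessors do not truncate. *)
Definition R_o (M : nat) : {poly rat} :=
  ((T (2 * M).-1)%:P + (1 + T M.-1)%:P * 'X) ^+ 2.

Definition L_e (M : nat) : {poly rat} :=
  \sum_(1 <= j < M.+1) (2 * j%:R - 1) ^+ 3 + 'X ^+ 3
  + \sum_(1 <= j < M.+1) (2 * j%:R + j%:R * 'X) ^+ 3.

Definition R_e (M : nat) : {poly rat} :=
  ((T (2 * M))%:P + (1 + T M)%:P * 'X) ^+ 2.

Definition P_o (m : nat) : {poly rat} :=
  \sum_(0 <= j < m.+1)
    (4 * j%:R + 1 + j%:R * 'X)
    * ((j%:R + 1) * (j%:R - 2) + j%:R ^+ 2 * 'X).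

(* Polynomials in the two variables m and x are elements of Q[x][m]: the outer
   variable is m, so that Q.[a] substitutes a for m. *)
Definition expands_P_o (Q : {poly {poly rat}}) : Prop :=
  forall m : nat, Q.[m%:R] = P_o m.

Lemma expands_P_o_exists : {Q : {poly {poly rat}} | expands_P_o Q}.
Proof.
pose c : {poly rat} := (12%:R^-1)%:P.
have c12 : 12%:R * c = 1 by rewrite /c -[12%:R]polyC_natr -polyCM mulfV.
have c12N (p : {poly rat}) : c * (12%:R * p) = p by rewrite mulrA [c * _]mulrC c12 mul1r.
exists (c%:P * ('X ^+ 2 * ('X + 1%:P) ^+ 2 * (12 + 15 * 'X + 3 * 'X ^+ 2)%:P
   - 'X * ('X + 1%:P) * ('X * 12%:P + 6%:P)
   - 'X * ('X + 1%:P) * (54 + 12 * 'X)%:P - ('X + 1%:P) * 24%:P)).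
move=> m; rewrite /P_o -[RHS]c12N hornerM hornerC; congr (_ * _).
rewrite !(hornerD, hornerN, hornerM, hornerC, hornerX, horner_exp).
elim: m => [|m IHm]; first by rewrite big_nat1; ring.
by rewrite big_nat_recr //= [RHS]mulrDr -IHm -natr1; ring.
Qed.

Lemma expands_P_o_unique (Q1 Q2 : {poly {poly rat}}) :
  expands_P_o Q1 -> expands_P_o Q2 -> Q1 = Q2.
Proof.
move=> h1 h2; apply/eqP; rewrite -subr_eq0; apply/eqP.
apply: (@roots_geq_poly_eq0 _ _ [seq (i%:R : {poly rat}) | i <- iota 0 (size (Q1 - Q2))]).
- apply/allP => _ /mapP[i _ ->]; rewrite /root !hornerE h1 h2 subrr eqxx //.
- rewrite map_inj_uniq ?iota_uniq // => i j /eqP.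
  by rewrite -!polyC_natr (inj_eq (@polyC_inj _)) eqr_nat => /eqP.
- by rewrite size_map size_iota.
Qed.

Definition P_expansion : {poly {poly rat}} := sval expands_P_o_exists.

Lemma P_expansionP : expands_P_o P_expansion.
Proof. exact: (svalP expands_P_o_exists). Qed.

(* The substitution m := - m - 1, carried out in the expansion. *)
Definition P_e (m : nat) : {poly rat} := P_expansion.[- m%:R - 1].

(* Main.v *)
(* Both differences satisfy the same first-order recurrence as x P. Writing
   t(n) for the base of the square R, the increment of R is
   (t(n+1) - t(n)) (2 t(n) + t(n+1) - t(n)), which is polynomial in n because
   2 T_n = n (n + 1); compare it with the increment of L. In the even case the
   recurrence P(a + 1) = P(a) + (summand at a + 1), valid for natural a, is
   first extended to all a by uniqueness of the expansion, then used at
   negative a, starting from P(-1) = 0. *)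
Require Import Defs.
From mathcomp Require Import all_boot all_order all_algebra.
From mathcomp Require Import ring.
Import GRing.Theory.
Local Open Scope ring_scope.

Lemma T0 : T 0 = 0.
Proof. by rewrite /T !mul0r. Qed.

Lemma TS (n : nat) : T n.+1 = T n + n.+1%:R.
Proof. by rewrite /T -natr1; field. Qed.

Lemma TSS (n : nat) : T n.+2 = T n + (n.+1 + n.+2)%:R.
Proof. by rewrite !TS -addrA -natrD. Qed.

Lemma double_polyC_T (n : nat) :
  2 * (T n)%:P = n%:R * (n%:R + 1) :> {poly rat}.
Proof.
have -> : 2 = 2%:R%:P :> {poly rat} by rewrite polyC_natr.
by rewrite -polyCM /T mulrC divfK // polyCM polyCD polyC_natr.
Qed.

(** Serves both parities: there [q] and [e] agree and only [p] and [d] differ. The factor 2 in the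
    cross term cancels the denominator of [T]. *)
Lemma sqrT_incr (p q : nat) (d e : rat) :
  ((T p + d)%:P + (1 + (T q + e))%:P * 'X) ^+ 2
  = ((T p)%:P + (1 + T q)%:P * 'X) ^+ 2
    + (d%:P + e%:P * 'X)
      * (p%:R * (p%:R + 1) + (2 + q%:R * (q%:R + 1)) * 'X
         + (d%:P + e%:P * 'X)).
Proof. by rewrite -!double_polyC_T !polyCD polyC1; ring. Qed.

(** The argument is a polynomial so that negative values can be substituted. *)
Definition P_summand (a : {poly rat}) : {poly rat} :=
  (4 * a + 1 + a * 'X) * ((a + 1) * (a - 2) + a ^+ 2 * 'X).

Lemma P_oS (m : nat) : P_o m.+1 = P_o m + P_summand m.+1%:R.
Proof. by rewrite /P_o big_nat_recr. Qed.

Lemma P_o0 : P_o 0 = - 2.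
Proof. by rewrite /P_o big_nat1; ring. Qed.

Lemma P_expansion_succ (a : {poly rat}) :
  P_expansion.[a + 1] = P_expansion.[a] + P_summand (a + 1).
Proof.
pose S : {poly {poly rat}} :=
  (4%:P * ('X + 1%:P) + 1%:P + ('X + 1%:P) * ('X)%:P)
  * (('X + 1%:P + 1%:P) * ('X + 1%:P - 2%:P) + ('X + 1%:P) ^+ 2 * ('X)%:P).
have SE b : S.[b] = P_summand (b + 1).
  by rewrite /S !(hornerD, hornerN, hornerM, hornerC, hornerX, horner_exp).
(* The expansion shifted by one, minus the last summand [S], takes the value [P_o m] at every
   natural [m], so it is the expansion itself. *)
have /(expands_P_o_unique P_expansionP) {2}-> :
    expands_P_o (P_expansion \Po ('X + 1%:P) - S).
  move=> m; rewrite hornerD hornerN horner_comp hornerD hornerX hornerC SE.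
  by rewrite natr1 P_expansionP P_oS addrK.
by rewrite hornerD hornerN horner_comp hornerD hornerX hornerC SE subrK.
Qed.

(** The step from -1 to 0 adds [P_summand 0], which is already all of [P_o 0]. *)
Lemma P_e0 : P_e 0 = 0.
Proof.
have := P_expansion_succ (-1); rewrite addNr (P_expansionP 0) P_o0.
rewrite /P_e oppr0 add0r => P0E; apply: (addIr (P_summand 0)).
by rewrite -[LHS]P0E /P_summand; ring.
Qed.

(** The recurrence from -m-2 to -m-1, read downwards. *)
Lemma P_eS (m : nat) : P_e m.+1 = P_e m - P_summand (- m%:R - 1).
Proof.
have := P_expansion_succ (- m.+1%:R - 1).
by rewrite subrK /P_e -natr1 opprD => ->; rewrite addrK.
Qed.

Lemma L_oS (m : nat) : L_o m.+2 = L_o m.+1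
  + (2 * m%:R + 3) ^+ 3 + ((m%:R + 1) * (2 + 'X)) ^+ 3.
Proof.
by rewrite /L_o !(@big_nat_recr _ _ _ m.+2) //= -!natr1; ring.
Qed.

Lemma L_eS (m : nat) : L_e m.+1 = L_e m
  + (2 * m%:R + 1) ^+ 3 + ((m%:R + 1) * (2 + 'X)) ^+ 3.
Proof.
by rewrite /L_e !(@big_nat_recr _ _ _ m.+1) //= -!natr1; ring.
Qed.

Lemma R_oS (m : nat) : R_o m.+2 = R_o m.+1
  + (4 * m%:R + 5 + (m%:R + 1) * 'X)
    * ((2 * m%:R + 1) * (2 * m%:R + 2) + (2 + m%:R * (m%:R + 1)) * 'X
       + (4 * m%:R + 5 + (m%:R + 1) * 'X)).
Proof.
rewrite /R_o !mulnS /= (TS m) TSS sqrT_incr !polyC_natr.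
by rewrite natrD -!natr1 !natrM; ring.
Qed.

Lemma R_eS (m : nat) : R_e m.+1 = R_e m
  + (4 * m%:R + 3 + (m%:R + 1) * 'X)
    * (2 * m%:R * (2 * m%:R + 1) + (2 + m%:R * (m%:R + 1)) * 'X
       + (4 * m%:R + 3 + (m%:R + 1) * 'X)).
Proof.
rewrite /R_e mulnS (TS m) TSS sqrT_incr !polyC_natr.
by rewrite natrD -!natr1 !natrM; ring.
Qed.

Lemma L_o_sub_R_o (m : nat) :
  L_o m.+1 - R_o m.+1 = 'X * P_o m - 'X ^+ 2 + 'X ^+ 3.
Proof.
elim: m => [|m IHm].
  by rewrite P_o0 /L_o /R_o big_nat1 big_geq // TS T0 !polyCD polyC0; ring.
have {}IHm : L_o m.+1 = R_o m.+1 + ('X * P_o m - 'X ^+ 2 + 'X ^+ 3).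
  by rewrite -IHm addrC subrK.
rewrite L_oS R_oS P_oS IHm -natr1 /P_summand; ring.
Qed.

Lemma L_e_sub_R_e (m : nat) : L_e m - R_e m = 'X * P_e m - 'X ^+ 2 + 'X ^+ 3.
Proof.
elim: m => [|m IHm].
  (* At 0 both sums are empty: the left side is ['X ^+ 3 - 'X ^+ 2]. *)
  by rewrite P_e0 /L_e /R_e !big_geq // T0 addr0 polyC0; ring.
have {}IHm : L_e m = R_e m + ('X * P_e m - 'X ^+ 2 + 'X ^+ 3).
  by rewrite -IHm addrC subrK.
rewrite L_eS R_eS P_eS IHm /P_summand; ring.
Qed.

Theorem theorem1 (m : nat) (hm : (2 <= m)%N) :
  L_o m.+1 - R_o m.+1 = 'X * P_o m - 'X ^+ 2 + 'X ^+ 3 /\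
  L_e m - R_e m = 'X * P_e m - 'X ^+ 2 + 'X ^+ 3.
Proof. by split; [apply: L_o_sub_R_o | apply: L_e_sub_R_e]. Qed.
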